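(* Let $S=(P,L)$ and $S'=(P',L')$ be two generalized quadrangles of order $(2,2)$, and let $x\mapsto x'$ ($x\in P$, $x'\in P'$) be an isomorphism from $S$ to $S'$. Define the point-line geometry $\mathcal{S}=(\mathcal{P},\mathcal{L})$ by $$\mathcal{P}=\{(x,y')\in P\times P' : y'\in x'^{\perp}\},$$ and let $\mathcal{L}$ consist of all $3$-subsets $\{(x,u'),(y,v'),(z,w')\}$ of $\mathcal{P}$ such that $T=\{x,y,z\}$ is a set of three distinct points of $S$ which is either a line of $S$ or a complete triad of $S$, and $\{u',v',w'\}=T'^{\perp}$ (computed in $S'$, where $T'=\{x',y',z'\}$), with $u',v',w'$ distinct. Then $\mathcal{S}$ is a slim dense near hexagon with parameters $(s,t,t_2)=(2,5,\{1,2\})$.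
   Context: A partial linear space is a point-line geometry in which lines are subsets of the point set of size at least 2 and any two distinct points lie on at most one line; two distinct points are collinear ($x\sim y$) if some line contains both. For a point $x$, $x^{\perp}=\{x\}\cup\{y: y\sim x\}$; for a set $A$ of points, $A^{\perp}=\bigcap_{x\in A}x^{\perp}$. A generalized quadrangle of order $(2,2)$ is a partial linear space with every line of size $3$ and every point on $3$ lines such that for every point $x$ and line $l$ with $x\notin l$ there is a unique point of $l$ collinear with $x$ (it is unique up to isomorphism, with 15 points and 15 lines). A triad of $S$ is a set of three pairwise non-collinear points; it is complete if $|T^{\perp}|=3$ (otherwise $|T^{\perp}|=1$). Distance $d(x,y)$ is distance in the collinearity graph. A near polygon is a connected partial linear space of finite diameter such that for every point $x$ and line $l$ with $x\notin l$ there is a unique point of $l$ nearest to $x$; a near hexagon is one of diameter $3$. It is slim if every line has exactly $3$ points, and dense if any two points at distance $2$ have at least two common neighbours. Parameters $(s,t,t_2)$ mean: every line has $s+1$ points, every point lies on $t+1$ lines, and $t_2+1=|x^{\perp}\cap y^{\perp}|$ for points $x,y$ at distance $2$, where $t_2$ ranges over the listed set of values. *)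

(* Defs.v *)
From mathcomp Require Import all_boot.
Set Implicit Arguments. Unset Strict Implicit. Unset Printing Implicit Defensive.

Section Geometry.
Variable T : finType.
Implicit Types (L : {set {set T}}) (Pt A : {set T}) (x y : T).

Definition collinear L x y : bool :=
  (x != y) && [exists l in L, (x \in l) && (y \in l)].

Definition perp L x : {set T} := [set y | (y == x) || collinear L x y].

Definition perpS L A : {set T} := \bigcap_(x in A) perp L x.

Definition partial_linear_space Pt L : Prop :=
  (forall l, l \in L -> l \subset Pt /\ 2 <= #|l|) /\
  (forall l1 l2 x y, l1 \in L -> l2 \in L -> x != y ->
     x \in l1 -> y \in l1 -> x \in l2 -> y \in l2 -> l1 = l2).

Definition triad L A : bool :=
  (#|A| == 3) && [forall x in A, forall y in A, ~~ collinear L x y].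
Definition complete_triad L A : bool := triad L A && (#|perpS L A| == 3).

(* generalized quadrangle of order (2,2) whose point set is all of T
   (nonempty, as the paper's GQ(2,2) has 15 points) *)
Definition GQ22 L : Prop :=
  0 < #|T| /\
  partial_linear_space [set: T] L /\
  (forall l, l \in L -> #|l| = 3) /\
  (forall x, #|[set l in L | x \in l]| = 3) /\
  (forall x l, l \in L -> x \notin l ->
     exists! y, y \in l /\ collinear L x y).

Definition ball L (k : nat) x : {set T} :=
  iter k (fun B => B :|: [set y | [exists z in B, collinear L z y]]) [set x].

(* distance in the collinearity graph (meaningful when connected) *)
Definition dist L x y : nat := find (fun k => y \in ball L k x) (iota 0 #|T|.+1).

Definition connected_geom Pt L : Prop :=
  forall x y, x \in Pt -> y \in Pt -> exists k, y \in ball L k x.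

Definition near_hexagon Pt L : Prop :=
  partial_linear_space Pt L /\
  connected_geom Pt L /\
  (forall x y, x \in Pt -> y \in Pt -> dist L x y <= 3) /\
  (exists x y, [/\ x \in Pt, y \in Pt & dist L x y = 3]) /\
  (forall x l, x \in Pt -> l \in L -> x \notin l ->
     exists! y, y \in l /\ forall z, z \in l -> z != y -> dist L x y < dist L x z).

Definition slim L : Prop := forall l, l \in L -> #|l| = 3.

Definition dense Pt L : Prop :=
  forall x y, x \in Pt -> y \in Pt -> dist L x y = 2 ->
    2 <= #|perp L x :&: perp L y|.

Definition has_parameters Pt L (s t : nat) (ts2 : seq nat) : Prop :=
  (forall l, l \in L -> #|l| = s.+1) /\
  (forall x, x \in Pt -> #|[set l in L | x \in l]| = t.+1) /\
  (forall x y, x \in Pt -> y \in Pt -> dist L x y = 2 ->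
     (#|perp L x :&: perp L y|).-1 \in ts2) /\
  (forall t2, t2 \in ts2 -> exists x y, [/\ x \in Pt, y \in Pt, dist L x y = 2 &
     (#|perp L x :&: perp L y|).-1 = t2]).

End Geometry.

Definition geom_iso (P P' : finType) (L : {set {set P}}) (L' : {set {set P'}})
  (f : P -> P') : Prop :=
  bijective f /\ forall l : {set P}, (l \in L) = (f @: l \in L').

Section Construction.
Variables (P P' : finType) (L : {set {set P}}) (L' : {set {set P'}}) (f : P -> P').

Definition cPoints : {set P * P'} := [set p | p.2 \in perp L' (f p.1)].

Definition cLines : {set {set P * P'}} :=
  [set l : {set P * P'} | [&& l \subset cPoints, #|l| == 3,
     #|[set p.1 | p in l]| == 3,
     ([set p.1 | p in l] \in L) || complete_triad L [set p.1 | p in l],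
     #|[set p.2 | p in l]| == 3 &
     [set p.2 | p in l] == perpS L' (f @: [set p.1 | p in l])]].

End Construction.

(* Main.v *)
Require Import Defs.
From mathcomp Require Import all_boot.
Set Implicit Arguments. Unset Strict Implicit. Unset Printing Implicit Defensive.

(** In a generalized quadrangle of order (2,2), let B(x, y) be 1 when x and y are distinct
    and noncollinear. A line meets the perp of a point in 1 or 3 of its points, so B(_, y)
    sums to 0 over every line; a parity argument shows that it also sums to 0 over every
    hyperbolic line {x, y}^perp^perp. Hence the points x and the perps of points are the
    points and planes of PG(3,2), the third point of the line xy being the sum x + y, and B
    is nonincidence.

    The new geometry depends only on this nonincidence relation: its points are the
    incident point-plane pairs (flags), and its lines are the triples of flags with distinct
    points and distinct planes in which every point lies on every plane. The distance of
    (x, u) and (y, v) is 3 if B(x, v) <> B(y, u), it is 2 if B(x, v) = B(y, u) = 1 or if just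
    one of x = y, u = v holds, and it is at most 1 otherwise. Given a flag (x, u) and a line
    with points p_1, p_2, p_3, either x is the point of some p_i or x lies on the plane of a
    single p_i, and dually for u with some p_j. If i = j the nearest point of the line is
    p_i, otherwise it is the third one. *)

Section SmallSets.
Variable T : finType.
Implicit Types (A : {set T}) (x y z : T).

Lemma card_setD1 A x n : #|A| = n.+1 -> x \in A -> #|A :\ x| = n.
Proof. by move=> An xA; move: An; rewrite (cardsD1 x) xA => -[]. Qed.

Lemma card3_third A x y : #|A| = 3 -> exists2 z, z \in A & (z != x) && (z != y).
Proof.
move=> A3; have /subsetPn[z zA] : ~~ (A \subset [set x; y]).
  by apply/negP => /subset_leq_card; rewrite A3 cards2; case: (x != y).
by rewrite !inE negb_or; exists z.
Qed.

Lemma card3_eq A x y z : #|A| = 3 -> x \in A -> y \in A -> z \in A ->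
  x != y -> x != z -> y != z -> A = [set x; y; z].
Proof.
move=> A3 xA yA zA xy xz yz; apply/esym/eqP; rewrite eqEcard A3; apply/andP; split.
  by apply/subsetP => w /setUP[/set2P[]|/set1P] ->.
by rewrite setUC cardsU1 cards2 xy !inE negb_or ![z == _]eq_sym xz yz.
Qed.

End SmallSets.

Lemma card_pencil_sum (T : finType) (Pt : {set T}) (L : {set {set T}}) (x : T) (A : {set T}) :
  partial_linear_space Pt L -> (forall y, y \in A -> collinear L x y) ->
  #|A| = \sum_(l in L | x \in l) #|l :&: A|.
Proof.
move=> [_ plsL] colA.
under [RHS]eq_bigr => l _ do rewrite -sum1_card.
rewrite (exchange_big_dep (mem A)) /= => [|l y _]; last by case/setIP.
rewrite -sum1_card; apply: eq_bigr => y yA.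
have /andP[xy /existsP[l /and3P[lL xl yl]]] := colA y yA.
rewrite (big_pred1 l) // => m /=; rewrite inE yA andbT.
apply/andP/eqP => [[/andP[mL xm] ym]|->]; last by rewrite lL xl.
exact: plsL xy _ _ _ _.
Qed.

Lemma card_collinear (T : finType) (Pt : {set T}) (L : {set {set T}}) (s : nat) (x : T) :
  partial_linear_space Pt L -> (forall l, l \in L -> #|l| = s.+1) ->
  #|[set y | collinear L x y]| = #|[set l in L | x \in l]| * s.
Proof.
move=> plsL cardL; rewrite (card_pencil_sum (x := x) plsL) => [|y]; last by rewrite inE.
rewrite -sum_nat_const big_set; apply: eq_bigr => l /andP[lL xl].
have -> : l :&: [set y | collinear L x y] = l :\ x.
  apply/setP => y; rewrite !inE [y == x]eq_sym andbC /collinear.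
  case yl: (y \in l); rewrite ?andbF // !andbT; apply: andb_idr => _.
  by apply/existsP; exists l; rewrite lL xl yl.
exact: card_setD1 (cardL l lL) xl.
Qed.

Section Distance.
Variables (T : finType) (L : {set {set T}}) (Pt : {set T}) (x : T) (d : T -> nat).

Definition distance_from : Prop :=
  [/\ forall y z, collinear L y z -> z \in Pt,
      forall y, y \in Pt -> (d y == 0) = (y == x),
      forall y z, y \in Pt -> collinear L y z -> d z <= (d y).+1 &
      forall y k, y \in Pt -> d y = k.+1 ->
        exists z, [/\ z \in Pt, collinear L z y & d z = k]].

Hypothesis xPt : x \in Pt.
Hypothesis dist_d : distance_from.

Lemma in_ball k y : (y \in ball L k x) = (y \in Pt) && (d y <= k).
Proof.
have [collinear_Pt d_eq0 d_step d_pred] := dist_d; elim: k y => [|k IH] y.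
  rewrite inE leqn0; apply/eqP/andP => [->|[yPt]]; last by rewrite d_eq0 // => /eqP.
  by rewrite d_eq0 ?eqxx.
rewrite /ball iterS -/(ball L k x) !inE IH.
apply/orP/andP => [[/andP[-> /leqW//]|/existsP[z]]|[yPt]].
  rewrite IH => /andP[/andP[zPt dz] zy]; split; first exact: collinear_Pt zy.
  exact: leq_trans (d_step _ _ zPt zy) _.
rewrite leq_eqVlt ltnS => /orP[/eqP dy|dy]; [right|by left; rewrite yPt].
have [z [zPt zy dz]] := d_pred _ _ yPt dy.
by apply/existsP; exists z; rewrite IH zPt dz leqnn.
Qed.

Lemma distance_from_lt_card y : y \in Pt -> d y < #|T|.
Proof.
move=> yPt; have [_ _ _ d_pred] := dist_d.
have attained k : k <= d y -> exists2 z, z \in Pt & d z = k.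
  move=> ky; rewrite -(subKn ky); elim: (d y - k) (leq_subr k (d y)) => [|j IH] jy.
    by exists y; rewrite ?subn0.
  have [z zPt dz] := IH (ltnW jy).
  have [|w [wPt _ dw]] := d_pred z (d y - j.+1) zPt; last by exists w.
  by rewrite dz subnSK.
rewrite -[(d y).+1](size_iota 0) cardE -(size_map d).
apply: uniq_leq_size (iota_uniq _ _) _ => k; rewrite mem_iota ltnS => /attained[z _ <-].
by apply: map_f; rewrite mem_enum.
Qed.

Lemma distance_fromE y : y \in Pt -> dist L x y = d y.
Proof.
move=> yPt; have ballE k : (y \in ball L k x) = (d y <= k) by rewrite in_ball yPt.
rewrite /dist (eq_find ballE); have lt_d := distance_from_lt_card yPt.
rewrite -(subnKC (leqW (ltnW lt_d))) iotaD find_cat.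
case: hasP => [[k]|_]; first by rewrite mem_iota add0n /= => k_lt; rewrite leqNgt k_lt.
by rewrite size_iota subSn 1?ltnW //= add0n leqnn addn0.
Qed.

End Distance.

Local Notation dual B := (fun u x => B x u).

(* [B x u] reads: the point [x] lies off the plane [u]. In PG(3,2) there are 7 planes through
   a point and 3 through a line. *)
Section Pairing.
Variables (P Q : finType) (B : P -> Q -> bool).
Implicit Types (x y z : P) (u : Q).

Definition orth x : {set Q} := [set u | ~~ B x u].

Definition orth2 x y : {set Q} := orth x :&: orth y.

(* Points are nonzero vectors over the field with two elements, so that the third point of
   the line through [x] and [y] is their sum. *)
Definition is_sum x y z : Prop := forall u, B z u = B x u (+) B y u.

Definition PG32_points : Prop :=
  [/\ forall x y, x != y -> exists z, is_sum x y z,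
      forall x, #|orth x| = 7 &
      forall x y, x != y -> #|orth2 x y| = 3].

Lemma in_orth2 x y u : (u \in orth2 x y) = ~~ B x u && ~~ B y u.
Proof. by rewrite !inE. Qed.

End Pairing.

Definition PG32 (P Q : finType) (B : P -> Q -> bool) : Prop :=
  PG32_points B /\ PG32_points (dual B).

Lemma PG32_dual (P Q : finType) (B : P -> Q -> bool) : PG32 B -> PG32 (dual B).
Proof. by case. Qed.

Section ProjectiveSpace.
Variables (P Q : finType) (B : P -> Q -> bool).
Hypothesis pgB : PG32 B.
Implicit Types (x y z : P) (u v w : Q).

Lemma sum_exists x y : x != y -> exists z, is_sum B x y z.
Proof. by case: pgB => -[+ _ _] _; apply. Qed.

Lemma card_orth x : #|orth B x| = 7.
Proof. by case: pgB => -[]. Qed.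

Lemma card_orth2 x y : x != y -> #|orth2 B x y| = 3.
Proof. by case: pgB => -[_ _ +] _; apply. Qed.

Lemma plane_separates x y : x != y -> exists2 u, ~~ B x u & B y u.
Proof.
move=> xy; have /subsetPn[u] : ~~ (orth B x \subset orth B y).
  apply: contraTN isT => /setIidPl xIy.
  by have := card_orth2 xy; rewrite /orth2 xIy card_orth.
by rewrite !inE negbK; exists u.
Qed.

Lemma eq_points x y : B x =1 B y -> x = y.
Proof.
move=> Bxy; apply/eqP; apply: contraT => /plane_separates[u].
by rewrite Bxy => /negbTE->.
Qed.

Lemma sum_neq x y z : x != y -> is_sum B x y z -> (z != x) && (z != y).
Proof.
move=> xy zE; have [u /negbTE xu yu] := plane_separates xy.
rewrite eq_sym in xy; have [v /negbTE yv xv] := plane_separates xy.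
by apply/andP; split; [have := zE u | have := zE v]; apply: contra_eq_neq => ->;
  rewrite ?xu ?yu ?xv ?yv.
Qed.

Lemma common_plane x y z : y != z -> exists u, [&& ~~ B x u, ~~ B y u & ~~ B z u].
Proof.
move=> yz; have /card_gt1P[u [v []]] : 1 < #|orth2 B y z| by rewrite card_orth2.
rewrite !in_orth2 => uyz vyz uv.
have [xu|xu] := boolP (B x u); last by exists u; rewrite xu.
have [xv|xv] := boolP (B x v); last by exists v; rewrite xv.
have [_ [/(_ u v uv)[w wE] _ _]] := pgB; exists w; rewrite !wE xu xv.
by case/andP: uyz vyz => /negbTE-> /negbTE-> /andP[/negbTE-> /negbTE->].
Qed.

Lemma orth2_sum x y z u v : u != v -> x != y -> x != z -> y != z ->
  x \in orth2 (dual B) u v -> y \in orth2 (dual B) u v -> z \in orth2 (dual B) u v ->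
  is_sum B x y z.
Proof.
move=> uv xy xz yz; have [_ [_ _ /(_ u v uv)]] := pgB; set X := orth2 _ u v => X3 xX yX zX.
have [t tE] := sum_exists xy; have /andP[tx ty] := sum_neq xy tE.
have : t \in X.
  move: xX yX; rewrite !in_orth2 !tE.
  by move=> /andP[/negbTE-> /negbTE->] /andP[/negbTE-> /negbTE->].
rewrite (card3_eq X3 xX yX zX) // !inE (negbTE tx) (negbTE ty) => /eqP tz.
by rewrite -tz.
Qed.

Lemma orthogonal_triple_sum (T : finType) (l : {set T}) (a : T -> P) (b : T -> Q) p q r :
    {in l &, injective a} -> {in l &, injective b} ->
    {in l &, forall s t, B (a s) (b t) = false} ->
    p \in l -> q \in l -> r \in l -> p != q -> p != r -> q != r ->
  is_sum B (a p) (a q) (a r).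
Proof.
move=> a_inj b_inj orth_ab pl ql rl pq pr qr.
by apply: (@orth2_sum _ _ _ (b p) (b q)); rewrite ?(inj_in_eq b_inj) ?(inj_in_eq a_inj) //;
  rewrite in_orth2 !orth_ab.
Qed.

End ProjectiveSpace.

(* The triples [a @: l] and [b @: l] are a line and the planes through it. If [x] is off this
   line then [c] is true and [b i] is the plane joining them, otherwise [x = a i]. *)
Lemma polar_dichotomy (P Q T : finType) (B : P -> Q -> bool) (l : {set T})
    (a : T -> P) (b : T -> Q) (x : P) :
    PG32 B -> #|l| = 3 -> {in l &, injective a} -> {in l &, injective b} ->
    {in l &, forall s t, B (a s) (b t) = false} ->
  exists i c, i \in l /\
    {in l, forall t, B x (b t) = c && (t != i) /\ (x == a t) = ~~ c && (t == i)}.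
Proof.
move=> pgB l3 a_inj b_inj orth_ab.
have [p [q [r [[pl ql rl] [pq qr rp]]]]] : exists p q r,
    [/\ p \in l, q \in l & r \in l] /\ [/\ p != q, q != r & r != p].
  by apply/card_gt2P; rewrite l3.
have pr : p != r by rewrite eq_sym.
have lE := card3_eq l3 pl ql rl pq pr qr.
have neqs := (eqxx, negbTE pq, negbTE qr, negbTE rp, negbTE pr,
  etrans (eq_sym q p) (negbTE pq), etrans (eq_sym r q) (negbTE qr)).
have orth_ba : {in l &, forall s t, B (a t) (b s) = false} by move=> s t sl tl; apply: orth_ab.
have br := orthogonal_triple_sum (PG32_dual pgB) b_inj a_inj orth_ba pl ql rl pq pr qr x.
have [x_off|] := boolP (B x (b p) || B x (b q)).
  have x_neq t : t \in l -> (x == a t) = false.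
    by move=> tl; apply: contraTF x_off => /eqP->; rewrite !orth_ab.
  have [i il iE] : exists2 i, i \in l & {in l, forall t, B x (b t) = (t != i)}.
    move: x_off br; case xp: (B x (b p)); case xq: (B x (b q)) => //= _ br;
      [exists r | exists q | exists p] => // t;
      by rewrite lE !inE => /orP[/orP[]|] /eqP->; rewrite ?xp ?xq ?br !neqs.
  by exists i, true; split=> // t tl; rewrite iE ?x_neq.
rewrite negb_or => x_orth; have [i il ->] : exists2 i, i \in l & x = a i.
  have X3 : #|orth2 (dual B) (b p) (b q)| = 3.
    by apply: (card_orth2 (PG32_dual pgB)); rewrite (inj_in_eq b_inj).
  have : x \in orth2 (dual B) (b p) (b q) by rewrite in_orth2.
  rewrite (card3_eq (x := a p) (y := a q) (z := a r) X3) ?in_orth2 ?orth_ab //;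
    rewrite ?(inj_in_eq a_inj) // !inE.
  by case/orP=> [/orP[]|] /eqP->; [exists p | exists q | exists r].
by exists i, false; split=> // t tl; rewrite orth_ab // (inj_in_eq a_inj) // eq_sym.
Qed.

Lemma PG32_comp (P P' Q : finType) (B : P' -> Q -> bool) (f : P -> P') :
  bijective f -> PG32 B -> PG32 (fun x u => B (f x) u).
Proof.
move=> bij_f [[sumP orthP orth2P] [sumQ orthQ orth2Q]].
have [f' fK f'K] := bij_f; have card_f (A : {set P'}) : #|f @^-1: A| = #|A|.
  by apply: on_card_preimset; apply: onW_bij.
split; split=> [x y xy|x|x y xy].
- have [|z zE] := sumP (f x) (f y); first by rewrite (can_eq fK).
  by exists (f' z) => u; rewrite f'K zE.
- exact: orthP.
- by apply: orth2P; rewrite (can_eq fK).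
- by have [z zE] := sumQ x y xy; exists z => u; apply: zE.
- by rewrite -(orthQ x) -card_f; apply: eq_card => y; rewrite !inE.
- by rewrite -(orth2Q x y xy) -card_f; apply: eq_card => z; rewrite !inE.
Qed.

Definition ncol (T : finType) (L : {set {set T}}) (x y : T) : bool := y \notin perp L x.

Section Noncollinearity.
Variables (T : finType) (L : {set {set T}}).

Lemma in_perp x y : (y \in perp L x) = ~~ ncol L x y.
Proof. by rewrite negbK. Qed.

Lemma collinear_sym : symmetric (collinear L).
Proof.
move=> x y; rewrite /collinear eq_sym; congr (_ && _).
by apply: eq_existsb => l; rewrite [(x \in l) && _]andbC.
Qed.

Lemma ncolE x y : ncol L x y = (x != y) && ~~ collinear L x y.
Proof. by rewrite /ncol inE negb_or eq_sym. Qed.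

Lemma ncol_sym : symmetric (ncol L).
Proof. by move=> x y; rewrite !ncolE eq_sym collinear_sym. Qed.

Lemma ncolxx x : ncol L x x = false.
Proof. by rewrite ncolE eqxx. Qed.

Lemma ncol_on_line l x y : l \in L -> x \in l -> y \in l -> ncol L x y = false.
Proof.
move=> lL xl yl; rewrite ncolE /collinear; case: eqP => //= _; apply/negbF/existsP.
by exists l; rewrite lL xl yl.
Qed.

Lemma line_through x y : x != y -> ~~ ncol L x y -> exists l, [/\ l \in L, x \in l & y \in l].
Proof.
by move=> xy; rewrite ncolE xy negbK => /andP[_ /existsP[l /and3P[]]]; exists l.
Qed.

Lemma orth_ncol x : orth (ncol L) x = perp L x.
Proof. by apply/setP => y; rewrite inE in_perp. Qed.

Lemma orth2_ncolP x y z : reflect (~~ ncol L x z /\ ~~ ncol L y z) (z \in orth2 (ncol L) x y).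
Proof. by rewrite in_orth2; apply: andP. Qed.

End Noncollinearity.

Section Quadrangle.
Variables (T : finType) (L : {set {set T}}).
Hypothesis gqL : GQ22 L.
Implicit Types (x y z p q u : T) (l : {set T}).

Local Notation ncol := (ncol L).

Lemma GQ22_card_line l : l \in L -> #|l| = 3.
Proof. by case: gqL => _ [_ [+ _]]; apply. Qed.

(* A point off [l] is collinear with one of its points, a point of [l] with all three:
   in both cases noncollinearity is additive on [l]. *)
Lemma ncol_line_foot u l : l \in L ->
  exists2 w, w \in l & {in l, forall v, ncol u v = (u \notin l) && (v != w)}.
Proof.
move=> lL; have [ul|ul] := boolP (u \in l).
  by exists u => // v vl; rewrite (ncol_on_line lL).
have [_ [_ [_ [_ /(_ u l lL ul)[w [[wl uw] wU]]]]]] := gqL.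
exists w => // v vl; rewrite ncolE (contraTneq _ vl) => [|<-//].
by congr (~~ _); apply/idP/eqP => [uv|->//]; apply/esym/wU.
Qed.

Lemma collinear_sum x y : x != y -> ~~ ncol x y -> exists z, is_sum ncol x y z.
Proof.
move=> xy /(line_through xy)[l [lL xl yl]].
have [z zl /andP[zx zy]] := card3_third x y (GQ22_card_line lL).
exists z => u; rewrite ![ncol _ u]ncol_sym.
have [w wl uE] := ncol_line_foot u lL; rewrite !uE //; case: (u \notin l) => //=.
have lE : l = [set x; y; z] by apply: card3_eq; rewrite ?GQ22_card_line ?[_ == z]eq_sym.
move: wl xy zx zy; rewrite lE !inE => /orP[/orP[]|] /eqP-> xy zx zy; rewrite eqxx ?zx ?zy ?xy //.
  by rewrite eq_sym xy.
by rewrite ![_ == z]eq_sym zx zy.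
Qed.

Lemma orth2_collinear l x y : l \in L -> x \in l -> y \in l -> x != y ->
  orth2 ncol x y = l.
Proof.
move=> lL xl yl xy; apply/setP => z; apply/orth2_ncolP/idP => [[xz yz]|zl]; last first.
  by rewrite !(ncol_on_line lL).
have [w wl uE] := ncol_line_foot z lL; apply: contraT => zl.
by move: xz yz xy; rewrite ![ncol _ z]ncol_sym !uE // zl !negbK => /eqP-> /eqP->; rewrite eqxx.
Qed.

Lemma card_pencil x : #|[set l in L | x \in l]| = 3.
Proof. by case: gqL => _ [_ [_ [+ _]]]; apply. Qed.

Lemma card_perp x : #|perp L x| = 7.
Proof.
have [_ [plsL _]] := gqL.
have -> : perp L x = x |: [set y | collinear L x y] by apply/setP => y; rewrite !inE.
by rewrite cardsU1 (card_collinear _ plsL GQ22_card_line) card_pencil inE /collinear eqxx.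
Qed.

Lemma card_orth2_ncol p q : ncol p q -> #|orth2 ncol p q| = 3.
Proof.
move=> pq; have [_ [plsL _]] := gqL.
rewrite (card_pencil_sum (x := p) plsL) => [|y /orth2_ncolP[py qy]]; last first.
  have p_y : p != y by apply: contraNneq qy => <-; rewrite ncol_sym.
  by move: py; rewrite ncolE p_y negbK.
rewrite -[RHS](card_pencil p) -sum1_card [RHS]big_set; apply: eq_bigr => l /andP[lL pl].
have [w wl uE] := ncol_line_foot q lL; have ql : q \notin l.
  by apply: contraL pq => ql; rewrite (ncol_on_line lL).
rewrite -(cards1 w); apply: eq_card => y; rewrite in_set1 inE.
apply/andP/eqP => [[yl /orth2_ncolP[_]]|->]; first by rewrite uE // ql negbK => /eqP.
by split=> //; apply/orth2_ncolP; rewrite (ncol_on_line lL) // uE // eqxx andbF.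
Qed.

Lemma card_orth2_neq x y : x != y -> #|orth2 ncol x y| = 3.
Proof.
move=> xy; have [/card_orth2_ncol//|/(line_through xy)[l [lL xl yl]]] := boolP (ncol x y).
by rewrite (orth2_collinear lL) // GQ22_card_line.
Qed.

Lemma ncol_in_orth2 p q x y : ncol p q -> x \in orth2 ncol p q -> y \in orth2 ncol p q ->
  x != y -> ncol x y.
Proof.
move=> pq /orth2_ncolP[px qx] /orth2_ncolP[py qy] xy; apply: contraTT pq => nxy.
have [l [lL xl yl]] := line_through xy nxy.
have orthE := orth2_collinear lL xl yl xy.
have [pl ql] : p \in l /\ q \in l.
  by split; rewrite -orthE; apply/orth2_ncolP; split; rewrite ncol_sym.
by rewrite (ncol_on_line lL).
Qed.

Section HyperbolicLine.
Variables p q : T.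
Hypothesis pq : ncol p q.

Let X := orth2 ncol p q.

Definition ncol_parity u : bool := \big[addb/false]_(x in X) ncol x u.

Lemma ncol_parity_sum x y z : is_sum ncol x y z ->
  ncol_parity z = ncol_parity x (+) ncol_parity y.
Proof.
move=> zE; rewrite /ncol_parity -big_split; apply: eq_bigr => w _ /=.
by rewrite ![ncol w _]ncol_sym.
Qed.

Lemma ncol_parity_orth u : (forall x, x \in X -> ~~ ncol u x) -> ncol_parity u = false.
Proof. by move=> uX; apply: big1 => x /uX/negbTE; rewrite ncol_sym. Qed.

Lemma ncol_parity_orth2 u : u \in X -> ncol_parity u = false.
Proof.
move=> uX; rewrite /ncol_parity (bigD1 u) //= ncolxx addFb.
under eq_bigr => x /andP[xX xu] do rewrite (ncol_in_orth2 pq xX uX xu).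
rewrite big_const (_ : #|_| = 2) //.
rewrite -(card_setD1 (card_orth2_ncol pq) uX).
by apply: eq_card => x; rewrite in_setD1 andbC.
Qed.

Lemma ncol_parity_perp r s u : ncol r s -> X = orth2 ncol r s -> ~~ ncol r u ->
  ncol_parity u = false.
Proof.
move=> rs XE ru; have parity_r : ncol_parity r = false.
  by apply: ncol_parity_orth => x; rewrite XE => /orth2_ncolP[].
have [->//|u_r] := eqVneq u r; rewrite eq_sym in u_r.
have [z zE] := collinear_sum u_r ru.
have [su|su] := boolP (ncol s u); last first.
  by apply: ncol_parity_orth2; rewrite XE; apply/orth2_ncolP.
have := ncol_parity_sum zE; rewrite parity_r addFb => <-; apply: ncol_parity_orth2.
have rz : ncol z r = false by rewrite zE ncolxx ncol_sym (negbTE ru).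
have sz : ncol z s = false by rewrite zE rs ncol_sym su.
by rewrite XE; apply/orth2_ncolP; rewrite ![ncol _ z]ncol_sym rz sz.
Qed.

(* Off the two perps, either [u] is collinear with all of [X], or it lies on a line that
   meets the perps of [p] and [q] in two distinct points. *)
Lemma ncol_parity0 u : ncol_parity u = false.
Proof.
have qp : ncol q p by rewrite ncol_sym.
have parity_p := ncol_parity_perp pq erefl.
have parity_q := ncol_parity_perp qp (setIC _ _).
have [pu|/parity_p//] := boolP (ncol p u); have [qu|/parity_q//] := boolP (ncol q u).
have [/forall_inP/ncol_parity_orth//|] := boolP [forall x in X, ~~ ncol u x].
rewrite negb_forall_in => /exists_inP[x /orth2_ncolP[px qx]]; rewrite negbK => ux.
have p_x : p != x by apply: contraNneq qx => <-.
have [a aE] := collinear_sum p_x px.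
have au : ncol a u = false by rewrite aE pu ncol_sym ux.
have ap : ncol a p = false by rewrite aE ncolxx ncol_sym (negbTE px).
have aq : ncol a q by rewrite aE pq ncol_sym (negbTE qx).
have a_u : a != u by apply: contraFneq ap => ->; rewrite ncol_sym.
have [|z zE] := collinear_sum a_u; first by rewrite au.
have qz : ncol q z = false by rewrite ncol_sym zE aq ncol_sym qu.
by have := ncol_parity_sum zE; rewrite parity_q ?qz // parity_p // ncol_sym ap.
Qed.

End HyperbolicLine.

Lemma hyperbolic_sum x y : ncol x y -> exists z, is_sum ncol x y z.
Proof.
move=> xy; have /card_gt1P[p [q []]] : 1 < #|orth2 ncol x y| by rewrite card_orth2_ncol.
move=> pX qX pq_neq; have pq := ncol_in_orth2 xy pX qX pq_neq.
have pq3 := card_orth2_ncol pq; case/orth2_ncolP: pX => xp yp; case/orth2_ncolP: qX => xq yq.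
have [z zX /andP[zx zy]] := card3_third x y pq3.
have [xX yX] : x \in orth2 ncol p q /\ y \in orth2 ncol p q.
  by split; apply/orth2_ncolP; split; rewrite ncol_sym.
have x_y : x != y by apply: contraTneq xy => ->; rewrite ncolxx.
have XE := card3_eq pq3 xX yX zX; exists z => u; have := ncol_parity0 pq u.
rewrite /ncol_parity XE ?[_ == z]eq_sym // setUC.
rewrite big_setU1 ?inE ?negb_or ?zx // big_setU1 ?inE // big_set1.
by move/negbT; rewrite negb_add => /eqP.
Qed.

Lemma GQ22_PG32 : PG32 ncol.
Proof.
have ncolPG : PG32_points ncol.
  split=> [x y xy|x|]; [|by rewrite orth_ncol card_perp|exact: card_orth2_neq].
  by have [/hyperbolic_sum|/(collinear_sum xy)] := boolP (ncol x y).
split=> //; case: ncolPG => sums perp7 perp3.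
split=> [x y /sums[z zE]|x|x y /perp3<-].
- by exists z => u; rewrite ![ncol u _]ncol_sym.
- by rewrite -(perp7 x); apply: eq_card => y; rewrite !inE ncol_sym.
- by apply: eq_card => z; rewrite !inE ![ncol z _]ncol_sym.
Qed.

Lemma line_or_complete_triad (A : {set T}) : #|A| = 3 -> #|perpS L A| = 3 ->
  (A \in L) || complete_triad L A.
Proof.
move=> A3 perpA3; rewrite /complete_triad /triad A3 perpA3 eqxx andbT /= orbC -implyNb.
rewrite negb_forall_in; apply/implyP => /exists_inP[x xA].
rewrite negb_forall_in => /exists_inP[y yA]; rewrite negbK => /andP[xy].
case/existsP=> l /and3P[lL xl yl]; have l_perp := orth2_collinear lL xl yl xy.
have perpAE : perpS L A = l.
  apply/eqP; rewrite eqEcard perpA3 GQ22_card_line // andbT -l_perp /orth2 !orth_ncol.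
  by apply/subsetP => z /bigcapP zA; rewrite inE !zA.
suff -> : A = l by [].
apply/eqP; rewrite eqEcard A3 GQ22_card_line // andbT; apply/subsetP => z zA.
rewrite -l_perp; apply/orth2_ncolP.
have perp_z w : w \in l -> ~~ ncol w z.
  by rewrite -perpAE => /bigcapP/(_ z zA); rewrite in_perp ncol_sym.
by split; apply: perp_z.
Qed.

End Quadrangle.

Section FlagGeometry.
Variables (P Q : finType) (B : P -> Q -> bool).
Implicit Types (p q r : P * Q) (l : {set P * Q}).

Definition flags : {set P * Q} := [set p | ~~ B p.1 p.2].

Definition flag_adj p q : bool :=
  [&& p.1 != q.1, p.2 != q.2, ~~ B p.1 q.2 & ~~ B q.1 p.2].

Definition flag_lines : {set {set P * Q}} :=
  [set l : {set P * Q} | [&& #|l| == 3, l \subset flags &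
    [forall p in l, forall q in l, (p != q) ==> flag_adj p q]]].

Definition flag_dist p q : nat :=
  if B p.1 q.2 (+) B q.1 p.2 then 3
  else if B p.1 q.2 || ((p.1 == q.1) (+) (p.2 == q.2)) then 2 else p != q.

Lemma in_flags p : (p \in flags) = ~~ B p.1 p.2.
Proof. by rewrite inE. Qed.

Lemma flag_adj_sym : symmetric flag_adj.
Proof.
move=> p q; rewrite /flag_adj ![q.1 == _]eq_sym ![q.2 == _]eq_sym.
by rewrite [~~ B q.1 _ && _]andbC.
Qed.

Lemma flag_adjxx p : flag_adj p p = false.
Proof. by rewrite /flag_adj eqxx. Qed.

Lemma flag_linesP l :
  reflect [/\ #|l| = 3, {in l, forall p, p \in flags} &
              {in l &, forall p q, p != q -> flag_adj p q}]
          (l \in flag_lines).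
Proof.
rewrite inE; apply: (iffP and3P) => [[/eqP l3 /subsetP lF /forall_inP l_adj]|[-> lF l_adj]].
  by split=> // p q pl ql; move/forall_inP: (l_adj p pl) => /(_ q ql)/implyP.
split=> //; first exact/subsetP.
by apply/forall_inP => p pl; apply/forall_inP => q ql; apply/implyP/l_adj.
Qed.

Lemma flag_lines_card l : l \in flag_lines -> #|l| = 3.
Proof. by case/flag_linesP. Qed.

Lemma flag_lines_orth l : l \in flag_lines -> {in l &, forall p q, B p.1 q.2 = false}.
Proof.
case/flag_linesP=> _ lF l_adj p q pl ql; apply/negbTE; case: (eqVneq p q) => [<-|].
  by rewrite -in_flags lF.
by case/(l_adj p q pl ql)/and4P.
Qed.

Lemma flag_lines_inj l : l \in flag_lines -> {in l &, injective fst} /\ {in l &, injective snd}.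
Proof.
case/flag_linesP=> _ _ l_adj; split=> p q pl ql E; apply/eqP; apply: contraT;
  by case/(l_adj p q pl ql)/and4P; rewrite E eqxx.
Qed.

Lemma flag_dist_eq0 p q : p \in flags -> (flag_dist p q == 0) = (q == p).
Proof.
rewrite in_flags => /negbTE pF; rewrite [q == p]eq_sym /flag_dist.
case: (eqVneq p q) => [<-|_]; first by rewrite pF !eqxx.
by do 2! case: ifP => // _.
Qed.

Lemma flag_dist_eq1 p q : (flag_dist p q == 1) = flag_adj p q.
Proof.
rewrite /flag_dist /flag_adj -pair_eqE /pair_eq.
by case: (B p.1 q.2) (B q.1 p.2) (p.1 == q.1) (p.2 == q.2) => [] [] [] [].
Qed.

Lemma flag_dist_le3 p q : flag_dist p q <= 3.
Proof. by rewrite /flag_dist; do 2! case: ifP => // _; case: eqVneq. Qed.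

Hypothesis pgB : PG32 B.

Lemma flag_adj_line p q : p \in flags -> q \in flags -> flag_adj p q ->
  exists l, [/\ l \in flag_lines, p \in l & q \in l].
Proof.
rewrite !in_flags => /negbTE pF /negbTE qF /and4P[n1 n2 /negbTE o1 /negbTE o2].
have [x xE] := sum_exists pgB n1; have [u uE] := sum_exists (PG32_dual pgB) n2.
have /andP[xp xq] := sum_neq pgB n1 xE; have /andP[up uq] := sum_neq (PG32_dual pgB) n2 uE.
pose r := (x, u); have adj_pq : flag_adj p q by rewrite /flag_adj n1 n2 o1 o2.
have adj_rp : flag_adj r p by rewrite /flag_adj xp up xE uE pF o1 o2.
have adj_rq : flag_adj r q by rewrite /flag_adj xq uq xE uE qF o1 o2.
have adj_neq a b : flag_adj a b -> a != b by apply: contraTneq => ->; rewrite flag_adjxx.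
exists [set p; q; r]; split; [|by rewrite !inE eqxx ?orbT..]; apply/flag_linesP; split.
- by rewrite setUC cardsU1 cards2 !inE negb_or !adj_neq.
- move=> a /setUP[/set2P[]|/set1P] ->; rewrite in_flags ?pF ?qF //=.
  by rewrite xE !uE pF qF o1 o2.
- move=> a b /setUP[/set2P[]|/set1P] -> /setUP[/set2P[]|/set1P] ->;
    by rewrite ?eqxx // flag_adj_sym.
Qed.

Lemma collinear_flag_lines p q :
  collinear flag_lines p q = [&& p \in flags, q \in flags & flag_adj p q].
Proof.
apply/andP/and3P => [[pq /existsP[l /and3P[lL pl ql]]]|[pF qF pq]].
  by have /flag_linesP[_ lF l_adj] := lL; rewrite !lF // l_adj.
split; first by apply: contraTneq pq => ->; rewrite flag_adjxx.
by have [l lP] := flag_adj_line pF qF pq; apply/existsP; exists l; apply/and3P.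
Qed.

Lemma flag_lines_sum l p q r : l \in flag_lines -> p \in l -> q \in l -> r \in l ->
  p != q -> p != r -> q != r -> is_sum B p.1 q.1 r.1 /\ is_sum (dual B) p.2 q.2 r.2.
Proof.
move=> lL pl ql rl pq pr qr; have [inj1 inj2] := flag_lines_inj lL.
have orth_l := flag_lines_orth lL.
split; first exact: (orthogonal_triple_sum pgB inj1 inj2 orth_l).
apply: (orthogonal_triple_sum (PG32_dual pgB) inj2 inj1) pl ql rl _ _ _ => // s t sl tl.
exact: orth_l.
Qed.

Lemma flag_lines_linear : partial_linear_space flags flag_lines.
Proof.
split=> [l|l m p q lL mL pq pl ql pm qm].
  by rewrite inE => /and3P[/eqP-> ? _].
have [r rl] := card3_third p q (flag_lines_card lL).
rewrite ![r == _]eq_sym => /andP[rp rq].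
have [s sm] := card3_third p q (flag_lines_card mL).
rewrite ![s == _]eq_sym => /andP[sp sq].
have [r1 r2] := flag_lines_sum lL pl ql rl pq rp rq.
have [s1 s2] := flag_lines_sum mL pm qm sm pq sp sq.
rewrite (card3_eq (flag_lines_card lL) pl ql rl) // (card3_eq (flag_lines_card mL) pm qm sm) //.
congr (_ :|: [set _]); rewrite [r]surjective_pairing [s]surjective_pairing; congr (_, _).
  by apply: (eq_points pgB) => u; rewrite r1 s1.
by apply: (eq_points (PG32_dual pgB)) => x; rewrite r2 s2.
Qed.

Lemma flag_dist_feet p l : p \in flags -> l \in flag_lines ->
  exists i j c e, [/\ i \in l, j \in l, c != e -> i = j &
    {in l, forall q, flag_dist p q =
      if (c && (q != i)) (+) (e && (q != j)) then 3
      else if c && (q != i) || ((~~ c && (q == i)) (+) (~~ e && (q == j))) then 2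
      else ~~ ((~~ c && (q == i)) && (~~ e && (q == j)))}].
Proof.
rewrite in_flags => pF lL; have l3 := flag_lines_card lL; have [inj1 inj2] := flag_lines_inj lL.
have orth_l := flag_lines_orth lL.
have orth_l' : {in l &, forall s t, B t.1 s.2 = false} by move=> s t sl tl; apply: orth_l.
have [i [c [il icE]]] := polar_dichotomy p.1 pgB l3 inj1 inj2 orth_l.
have [j [e [jl jeE]]] := polar_dichotomy p.2 (PG32_dual pgB) l3 inj2 inj1 orth_l'.
exists i, j, c, e; split=> // [|q ql]; last first.
  rewrite /flag_dist -pair_eqE /pair_eq.
  by have [-> ->] := icE q ql; have [-> ->] := jeE q ql.
move=> ce; apply/eqP; apply: contraNT pF => i_j.
have [[_ p1] [j1 _]] := (icE i il, icE j jl); have [[_ p2] [i2 _]] := (jeE j jl, jeE i il).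
move: ce i2 j1 p1 p2; rewrite i_j [j == i]eq_sym i_j !eqxx !andbT.
by case: (c) (e) => [] [] //= _ i2 j1 /eqP p1 /eqP p2; rewrite ?p2 ?j1 // p1 i2.
Qed.

Lemma flag_dist_line p l : p \in flags -> l \in flag_lines ->
  exists2 q, q \in l & {in l, forall r, r != q -> flag_dist p r = (flag_dist p q).+1}.
Proof.
move=> pF lL; have l3 := flag_lines_card lL.
have [i [j [c [e [il jl ce distE]]]]] := flag_dist_feet pF lL.
have [ij|i_j] := eqVneq i j.
  rewrite -{j}ij in jl ce distE; exists i => // q ql /negbTE qi.
  by rewrite !distE // qi eqxx; case: (c) (e) => [] [].
have {}ce : e = c by apply/eqP; rewrite eq_sym; apply: contraNT i_j => /ce->.
have [k kl /andP[/negbTE ki /negbTE kj]] := card3_third i j l3.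
exists k => // q ql qk; have : q \in [set i; j; k].
  by rewrite -(card3_eq l3 il jl kl) // eq_sym ?ki ?kj.
rewrite !inE (negbTE qk) orbF !distE // ce ki kj => /orP[] /eqP->; rewrite eqxx.
  by rewrite (negbTE i_j); case: (c).
by rewrite [j == i]eq_sym (negbTE i_j); case: (c).
Qed.

Definition flag_common p q : {set P * Q} :=
  [set r in flags | flag_adj p r && flag_adj q r].

Lemma in_flag_common p q r :
  (r \in flag_common p q) = [&& r \in flags, flag_adj p r & flag_adj q r].
Proof. by rewrite [LHS]inE. Qed.

Lemma card_flag_common_opposite p q : p \in flags -> q \in flags ->
  B p.1 q.2 -> B q.1 p.2 -> #|flag_common p q| = 3.
Proof.
rewrite !in_flags => pF qF pq qp.
have pq1 : p.1 != q.1 by apply: contraTneq qp => <-.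
have pq2 : p.2 != q.2 by apply: contraTneq qp => ->.
have inj1 : {in flag_common p q &, injective fst}.
  move=> [x u] [y v]; rewrite !in_flag_common !in_flags /flag_adj /=.
  case/and3P=> xu /and4P[px pu pxu pxp] /and4P[qx qu qxu qxq].
  case/and3P=> yv /and4P[_ _ pv _] /and4P[_ _ qv _] xy; rewrite -{}xy in yv *.
  congr (_, _); apply/eqP; apply: contraT => uv.
  have := orth2_sum pgB uv pq1 px qx; rewrite !in_orth2 pxu pv qxu qv xu yv.
  by move=> /(_ isT isT isT p.2); rewrite (negbTE pF) qp (negbTE pxp).
rewrite -(card_in_imset inj1) -(card_orth2 (PG32_dual pgB) pq2); apply: eq_card => x.
rewrite in_orth2; apply/imsetP/andP => [[r + ->]|[xp xq]].
  by rewrite in_flag_common => /and3P[_ /and4P[_ _ _ ->] /and4P[_ _ _ ->]].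
have [u /and3P[xu pu qu]] := common_plane pgB x pq1.
have [p_x q_x] : p.1 != x /\ q.1 != x.
  by split; [apply: contraTneq pq | apply: contraTneq qp] => ->.
have [p_u q_u] : p.2 != u /\ q.2 != u.
  by split; [apply: contraTneq qp | apply: contraTneq pq] => ->.
by exists (x, u); rewrite // in_flag_common in_flags /flag_adj /= p_x q_x p_u q_u xu pu qu xp.
Qed.

Lemma card_flag_common_same_point p q : p \in flags -> q \in flags ->
  p.1 = q.1 -> p.2 != q.2 -> #|flag_common p q| = 2.
Proof.
rewrite !in_flags => pF qF pq1 pq2; rewrite -pq1 in qF.
have [u uE] := sum_exists (PG32_dual pgB) pq2.
have /andP[up uq] := sum_neq (PG32_dual pgB) pq2 uE.
suff -> : flag_common p q = setX (orth2 (dual B) p.2 q.2 :\ p.1) [set u].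
  rewrite cardsX cards1 muln1; apply: card_setD1 (card_orth2 (PG32_dual pgB) pq2) _.
  by rewrite in_orth2 pF qF.
apply/setP => -[x v]; rewrite in_setX in_setD1 in_orth2 in_set1 /= in_flag_common in_flags.
rewrite /flag_adj -pq1 [x == _]eq_sym /=.
apply/and3P/andP => [[xv /and4P[px pv pxv xp] /and4P[_ qv _ xq]]|[/and3P[px xp xq] /eqP->]].
  rewrite px xp xq; split=> //; apply/eqP/(eq_points (PG32_dual pgB)) => y; rewrite uE.
  by apply: (orth2_sum (PG32_dual pgB) px pq2 pv qv); rewrite in_orth2 ?pF ?qF ?xp ?xq ?pxv.
rewrite px xp xq ![_ == u]eq_sym up uq !uE.
by rewrite (negbTE xp) (negbTE xq) (negbTE pF) (negbTE qF).
Qed.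

Lemma card_flag_adj p : p \in flags -> #|[set q in flags | flag_adj p q]| = 12.
Proof.
rewrite in_flags => pF; pose X := orth (dual B) p.2 :\ p.1.
have X6 : #|X| = 6 by apply: card_setD1 (card_orth (PG32_dual pgB) p.2) _; rewrite inE.
transitivity (\sum_(x in X) \sum_(u in orth2 B p.1 x :\ p.2) 1).
  rewrite pair_big_dep sum1_card; apply: eq_card => -[x u].
  rewrite [LHS]inE in_flags [RHS]unfold_in /= /X !in_setD1 in_orth2 inE /flag_adj /=.
  rewrite [p.1 == x]eq_sym [p.2 == u]eq_sym.
  by case: (B x u) (B x p.2) (B p.1 u) (x == p.1) (u == p.2) => [] [] [] [] [].
rewrite (eq_bigr (fun=> 2)) ?sum_nat_const ?X6 // => x; rewrite in_setD1 inE => /andP[xp px].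
rewrite eq_sym in xp; rewrite sum1_card; apply: card_setD1 (card_orth2 pgB xp) _.
by rewrite in_orth2 pF.
Qed.

End FlagGeometry.

Section SwapDuality.
Variables (P Q : finType) (B : P -> Q -> bool).
Implicit Types p q : P * Q.

Lemma flag_adj_swap p q : flag_adj (dual B) (swap_pair p) (swap_pair q) = flag_adj B p q.
Proof. by rewrite /flag_adj /= andbCA [~~ B q.1 _ && _]andbC. Qed.

Lemma card_flag_common_same_plane p q : PG32 B -> p \in flags B -> q \in flags B ->
  p.2 = q.2 -> p.1 != q.1 -> #|flag_common B p q| = 2.
Proof.
move=> pgB pF qF pq2 pq1; rewrite in_flags in pF; rewrite in_flags in qF.
have swap_bij : bijective (@swap_pair P Q) by exists swap_pair => -[].
have dual2 := card_flag_common_same_point (PG32_dual pgB) (p := swap_pair p) (q := swap_pair q).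
rewrite -dual2 ?in_flags // -(on_card_preimset (onW_bij _ swap_bij)); apply: eq_card => r.
by rewrite [RHS]inE !in_flag_common !in_flags !flag_adj_swap.
Qed.

End SwapDuality.

Section FlagNearHexagon.
Variables (P Q : finType) (B : P -> Q -> bool).
Hypothesis pgB : PG32 B.

Local Notation F := (flags B).
Local Notation Ln := (flag_lines B).

Lemma flag_dist2_cases p q : flag_dist B p q = 2 ->
  [\/ B p.1 q.2 /\ B q.1 p.2, p.1 = q.1 /\ p.2 != q.2 | p.2 = q.2 /\ p.1 != q.1].
Proof.
rewrite /flag_dist; case: (B p.1 q.2); case: (B q.1 p.2) => //=; first by constructor.
rewrite -pair_eqE /pair_eq; case: eqP => [pq1|_]; case: eqP => [pq2|_] //= _.
  by constructor 2.
by constructor 3.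
Qed.

Lemma card_flag_common p q : p \in F -> q \in F -> flag_dist B p q = 2 ->
  #|flag_common B p q| \in [:: 2; 3].
Proof.
move=> pF qF /flag_dist2_cases[[pq qp]|[pq1 pq2]|[pq2 pq1]].
- by rewrite (card_flag_common_opposite pgB).
- by rewrite (card_flag_common_same_point pgB).
- by rewrite (card_flag_common_same_plane pgB).
Qed.

Lemma flag_dist_step p q r : p \in F -> collinear Ln q r ->
  flag_dist B p r <= (flag_dist B p q).+1.
Proof.
move=> pF /andP[qr /existsP[l /and3P[lL ql rl]]].
have [s sl sdist] := flag_dist_line pgB pF lL.
have [->|/(sdist r rl)->] := eqVneq r s; have [->|/(sdist q ql)->] := eqVneq q s;
  by rewrite // leqW.
Qed.

Lemma flag_dist_pred p q k : p \in F -> q \in F -> flag_dist B p q = k.+1 ->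
  exists r, [/\ r \in F, collinear Ln r q & flag_dist B p r = k].
Proof.
move=> pF qF dpq; have := flag_dist_le3 B p q.
case: k dpq => [/eqP|[|[|k]]] dpq; rewrite ?dpq // => _.
- rewrite flag_dist_eq1 in dpq; exists p; rewrite collinear_flag_lines // pF qF dpq.
  by split=> //; apply/eqP; rewrite flag_dist_eq0.
- have /card_gt0P[r] : 0 < #|flag_common B p q|.
    by have := card_flag_common pF qF dpq; rewrite !inE => /orP[] /eqP->.
  rewrite in_flag_common => /and3P[rF pr qr]; exists r.
  rewrite collinear_flag_lines // rF qF flag_adj_sym; split=> //.
  by apply/eqP; rewrite flag_dist_eq1.
have /card_gt0P[r] : 0 < #|[set r in F | flag_adj B q r]| by rewrite card_flag_adj.
rewrite inE => /andP[rF qr]; have [l [lL ql rl]] := flag_adj_line pgB qF rF qr.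
have [s sl sdist] := flag_dist_line pgB pF lL.
have rq : r != q by apply: contraTneq qr => ->; rewrite flag_adjxx.
have qs : q != s.
  by apply: contraTneq (flag_dist_le3 B p r) => qs; rewrite -qs in sdist; rewrite sdist // dpq.
have := sdist q ql qs; rewrite dpq => -[ds]; exists s.
have /flag_linesP[_ lF l_adj] := lL.
by rewrite collinear_flag_lines // qF flag_adj_sym l_adj // lF.
Qed.

Lemma flag_distance p : p \in F -> distance_from Ln F p (flag_dist B p).
Proof.
move=> pF; split=> [q r|q _|q r _|q k].
- by rewrite collinear_flag_lines // => /and3P[].
- exact: flag_dist_eq0.
- exact: flag_dist_step.
- exact: flag_dist_pred.
Qed.

Lemma dist_flag_lines p q : p \in F -> q \in F -> dist Ln p q = flag_dist B p q.
Proof. by move=> pF; apply: distance_fromE (flag_distance pF) _. Qed.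

Lemma flag_lines_connected : connected_geom F Ln.
Proof.
move=> p q pF qF; exists (flag_dist B p q).
by rewrite (in_ball pF (flag_distance pF)) qF leqnn.
Qed.

Lemma flag_lines_nearest p l : p \in F -> l \in Ln ->
  exists! q, q \in l /\ forall r, r \in l -> r != q -> dist Ln p q < dist Ln p r.
Proof.
move=> pF lL; have [q ql qdist] := flag_dist_line pgB pF lL.
have distE r : r \in l -> dist Ln p r = flag_dist B p r.
  by move=> rl; rewrite dist_flag_lines //; have /flag_linesP[_ -> //] := lL.
exists q; split=> [|r [rl rmin]]; first by split=> // r rl rq; rewrite !distE // (qdist r).
apply/eqP; apply: contraT => qr; have := rmin q ql qr.
by rewrite !distE // (qdist r rl) 1?eq_sym // ltnNge leqnSn.
Qed.

Lemma card_flag_pencil p : p \in F -> #|[set l in Ln | p \in l]| = 6.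
Proof.
move=> pF; have := card_collinear (s := 2) p (flag_lines_linear pgB) (@flag_lines_card _ _ B).
rewrite (_ : #|_| = 6 * 2) => [/eqP|]; first by rewrite eqn_pmul2r // => /eqP.
rewrite -[RHS](card_flag_adj pgB pF); apply: eq_card => q.
by rewrite [LHS]inE [RHS]inE collinear_flag_lines // pF.
Qed.

Lemma flag_perpI p q : p \in F -> q \in F -> dist Ln p q = 2 ->
  perp Ln p :&: perp Ln q = flag_common B p q.
Proof.
move=> pF qF; rewrite dist_flag_lines // => d2.
have npq : flag_adj B p q = false by rewrite -flag_dist_eq1 d2.
have p_q : (q == p) = false by rewrite -(flag_dist_eq0 _ pF) d2.
apply/setP => r; rewrite in_flag_common in_setI ![_ \in perp _ _]inE.
rewrite !collinear_flag_lines // pF qF; have [->|_] := eqVneq r p.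
  by rewrite [p == q]eq_sym p_q flag_adjxx flag_adj_sym npq !andbF.
by have [->|_] := eqVneq r q; rewrite ?npq ?andbF //= andbACA andbb.
Qed.

Lemma card_flag_perpI p q : p \in F -> q \in F -> dist Ln p q = 2 ->
  #|perp Ln p :&: perp Ln q| \in [:: 2; 3].
Proof.
by move=> pF qF d2; rewrite flag_perpI // card_flag_common -?dist_flag_lines.
Qed.

Hypothesis P_gt0 : 0 < #|P|.

Lemma flag_off_plane : exists p u, p \in F /\ B p.1 u.
Proof.
have [x _] := card_gt0P P_gt0.
have /card_gt0P[v] : 0 < #|orth B x| by rewrite card_orth.
rewrite inE => xv; have /card_gt0P[y] : 0 < #|orth (dual B) v :\ x|.
  by rewrite (card_setD1 (card_orth (PG32_dual pgB) v)) // inE.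
rewrite in_setD1 => /andP[y_x _]; have [u _ xu] := plane_separates pgB y_x.
by exists (x, v), u; rewrite in_flags.
Qed.

Lemma flag_dist3_exists : exists p q, [/\ p \in F, q \in F & flag_dist B p q = 3].
Proof.
have [p [u [pF pu]]] := flag_off_plane.
have p_u : p.2 != u by apply: contraTneq pu => <-; rewrite -in_flags.
have /card_gt0P[y] : 0 < #|orth2 (dual B) p.2 u| by rewrite (card_orth2 (PG32_dual pgB)).
rewrite in_orth2 => /andP[yp yu]; exists p, (y, u).
by rewrite pF in_flags /flag_dist /= pu (negbTE yp).
Qed.

Lemma card_flag_common_attained n : n \in [:: 2; 3] ->
  exists p q, [/\ p \in F, q \in F, flag_dist B p q = 2 & #|flag_common B p q| = n].
Proof.
have [p [u [pF pu]]] := flag_off_plane; rewrite !inE => /orP[] /eqP->.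
  have /card_gt0P[v] : 0 < #|orth B p.1 :\ p.2|.
    by rewrite (card_setD1 (card_orth pgB p.1)) // inE -in_flags.
  rewrite in_setD1 inE => /andP[pv2 pv]; have qF : (p.1, v) \in F by rewrite in_flags.
  exists p, (p.1, v); split=> //; last by rewrite (card_flag_common_same_point pgB) // eq_sym.
  rewrite in_flags in pF.
  by rewrite /flag_dist /= (negbTE pv) (negbTE pF) eqxx eq_sym (negbTE pv2).
have u_p : u != p.2 by apply: contraTneq pu => ->; rewrite -in_flags.
have [y yu yp] := plane_separates (PG32_dual pgB) u_p; have qF : (y, u) \in F by rewrite in_flags.
exists p, (y, u); split=> //; first by rewrite /flag_dist /= pu yp.
by rewrite (card_flag_common_opposite pgB).
Qed.

Lemma flag_near_hexagon : near_hexagon F Ln.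
Proof.
split; first exact: flag_lines_linear.
split; first exact: flag_lines_connected.
split; first by move=> p q pF qF; rewrite dist_flag_lines ?flag_dist_le3.
split; last by move=> p l pF lL _; apply: flag_lines_nearest.
by have [p [q [pF qF d3]]] := flag_dist3_exists; exists p, q; rewrite dist_flag_lines.
Qed.

Lemma flag_dense : dense F Ln.
Proof. by move=> p q pF qF /(card_flag_perpI pF qF); rewrite !inE => /orP[] /eqP->. Qed.

Lemma flag_parameters : has_parameters F Ln 2 5 [:: 1; 2].
Proof.
split; first exact: flag_lines_card.
split; first exact: card_flag_pencil.
split=> [p q pF qF /(card_flag_perpI pF qF)|n n12]; first by rewrite !inE => /orP[] /eqP->.
have [|p [q [pF qF d2 cpq]]] := @card_flag_common_attained n.+1.
  by move: n12; rewrite !inE !eqSS.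
by exists p, q; rewrite dist_flag_lines // flag_perpI ?dist_flag_lines // cpq.
Qed.

End FlagNearHexagon.

Section Isomorphism.
Variables (P P' : finType) (L : {set {set P}}) (L' : {set {set P'}}) (f : P -> P').
Hypothesis isoLL' : geom_iso L L' f.

Lemma collinear_iso x y : collinear L' (f x) (f y) = collinear L x y.
Proof.
have [[f' fK f'K] linesE] := isoLL'; rewrite /collinear (can_eq fK); congr (_ && _).
apply/existsP/existsP => -[l /and3P[lL xl yl]].
  exists (f' @: l); rewrite linesE -imset_comp (eq_imset _ f'K) imset_id lL.
  by rewrite -[x]fK -[y]fK !imset_f.
by exists (f @: l); rewrite -linesE lL !imset_f.
Qed.

Lemma ncol_iso x y : ncol L' (f x) (f y) = ncol L x y.
Proof. by have [[f' fK _] _] := isoLL'; rewrite !ncolE collinear_iso (can_eq fK). Qed.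

Lemma card_perpS_iso A : #|perpS L A| = #|perpS L' (f @: A)|.
Proof.
have [bij_f _] := isoLL'; rewrite -(on_card_preimset (onW_bij _ bij_f)).
apply: eq_card => y; rewrite [RHS]inE; apply/bigcapP/bigcapP => yA x.
  by case/imsetP=> z zA ->; rewrite in_perp ncol_iso -in_perp yA.
by move=> xA; rewrite in_perp -ncol_iso -in_perp yA // imset_f.
Qed.

End Isomorphism.

Section Construction.
Variables (P P' : finType) (L : {set {set P}}) (L' : {set {set P'}}) (f : P -> P').
Hypothesis gqL : GQ22 L.
Hypothesis gqL' : GQ22 L'.
Hypothesis isoLL' : geom_iso L L' f.

Local Notation B := (fun x u => ncol L' (f x) u).

Lemma PG32_iso : PG32 B.
Proof. by have [bij_f _] := isoLL'; apply: PG32_comp bij_f (GQ22_PG32 gqL'). Qed.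

Lemma cPointsE : cPoints L' f = flags B.
Proof. by apply/setP => p; rewrite in_flags inE in_perp. Qed.

Lemma in_perpS_imset (A : {set P}) u :
  reflect {in A, forall x, ~~ B x u} (u \in perpS L' (f @: A)).
Proof.
apply: (iffP bigcapP) => [uA x xA|uA x' /imsetP[x xA ->]]; last by rewrite in_perp uA.
by rewrite -in_perp uA // imset_f.
Qed.

(* Requiring the first coordinates to form a line or a complete triad is redundant, because
   three points with three common neighbours always do. *)
Lemma cLinesE : cLines L L' f = flag_lines B.
Proof.
apply/setP => l; rewrite [LHS]inE cPointsE; apply/and5P/idP.
  case=> lF l3 l1 _ /andP[l2 /eqP perp_l].
  have inj1 : {in l &, injective fst} by apply/imset_injP; rewrite (eqP l3).
  have inj2 : {in l &, injective snd} by apply/imset_injP; rewrite (eqP l3).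
  apply/flag_linesP; split; [exact/eqP | exact/subsetP |].
  have orth_l p q : p \in l -> q \in l -> ~~ B p.1 q.2.
    move=> pl ql; have : q.2 \in [set r.2 | r in l] by apply: imset_f.
    by rewrite perp_l => /in_perpS_imset; apply; apply: imset_f.
  by move=> p q pl ql pq; rewrite /flag_adj (inj_in_eq inj1) // (inj_in_eq inj2) // pq !orth_l.
move=> lL; have [inj1 inj2] := flag_lines_inj lL; have l3 := flag_lines_card lL.
have A3 : #|[set p.1 | p in l]| = 3 by rewrite card_in_imset.
have perp_l : [set p.2 | p in l] = perpS L' (f @: [set p.1 | p in l]).
  have /card_gt1P[p [q [pl ql pq]]] : 1 < #|l| by rewrite l3.
  apply/eqP; rewrite eqEcard card_in_imset // l3; apply/andP; split.
    apply/subsetP => _ /imsetP[q' ql' ->]; apply/in_perpS_imset => _ /imsetP[p' pl' ->].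
    by rewrite (flag_lines_orth lL).
  have pq1 : p.1 != q.1 by rewrite (inj_in_eq inj1).
  rewrite -(card_orth2 PG32_iso pq1); apply/subset_leq_card/subsetP => u /in_perpS_imset uA.
  by rewrite in_orth2 !uA ?imset_f.
split; rewrite ?A3 ?l3 //; first by case/flag_linesP: lL => _ lF _; apply/subsetP.
  apply: (line_or_complete_triad gqL) => //.
  by rewrite (card_perpS_iso isoLL') -perp_l card_in_imset.
by rewrite -perp_l card_in_imset // l3 !eqxx.
Qed.

End Construction.

Theorem theorem2p1 (P P' : finType) (L : {set {set P}}) (L' : {set {set P'}})
  (f : P -> P') :
  GQ22 L -> GQ22 L' -> geom_iso L L' f ->
  near_hexagon (cPoints L' f) (cLines L L' f) /\
  slim (cLines L L' f) /\
  dense (cPoints L' f) (cLines L L' f) /\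
  has_parameters (cPoints L' f) (cLines L L' f) 2 5 [:: 1; 2].
Proof.
move=> gqL gqL' isoLL'; have pgB := PG32_iso gqL' isoLL'; have [P_gt0 _] := gqL.
rewrite (cLinesE gqL gqL' isoLL') cPointsE; split; first exact: flag_near_hexagon.
split; first exact: flag_lines_card.
by split; [exact: flag_dense | exact: flag_parameters].
Qed.
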